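(* Let $m\ge0$ be an integer and let $\rho,\alpha_1$ be complex numbers with $\rho^2\neq1$. Then, as formal power series in $t$, $$\sum_{n=0}^{\infty}\frac{(n+m)!\,2^{n+m}}{n!\,m!}\Big[U_{n+m}(\rho)+\big(\tfrac{\alpha_1}{2}-\rho\big)U_{n+m-1}(\rho)\Big]C_n^{(m+1)}(x)t^n=\frac{c_1}{\big(t_1-xt-(\frac{t_1}{4}-\frac\rho2)t^2\big)^{m+1}}+\frac{c_2}{\big(t_2-xt-(\frac{t_2}{4}-\frac\rho2)t^2\big)^{m+1}},$$ where $t_1=\rho-\sqrt{\rho^2-1}$, $t_2=\rho+\sqrt{\rho^2-1}$, and $$c_1=\frac{1+(\alpha_1-2\rho)t_1}{t_2-t_1},\qquad c_2=\frac{1+(\alpha_1-2\rho)t_2}{t_1-t_2}.$$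
   Context: $C_n^{(\lambda)}(x)$ denotes the monic Gegenbauer polynomials: $C_{-1}^{(\lambda)}=0$, $C_0^{(\lambda)}=1$, $C_{n+1}^{(\lambda)}(x)=xC_n^{(\lambda)}(x)-\frac{n(n-1+2\lambda)}{4(n+\lambda)(n-1+\lambda)}C_{n-1}^{(\lambda)}(x)$ (for $\lambda>0$). $U_n=C_n^{(1)}$ is the monic Chebyshev polynomial of the second kind (that is, $2^{-n}$ times the usual one), with $U_{-1}=0$. *)

(* Defs.v *)
From HB Require Import structures.
From mathcomp Require Import all_boot all_order all_algebra.
From mathcomp Require Import boolp reals complex.

Set Implicit Arguments.
Unset Strict Implicit.
Unset Printing Implicit Defensive.

Import GRing.Theory.
Local Open Scope ring_scope.


(* A record rather than an alias of [nat -> R], so that the Cauchy product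
   cannot be confused with the pointwise product of functions. *)
Record fps (R : Type) := Fps { fps_coef : nat -> R }.

HB.instance Definition _ (R : Type) := gen_eqMixin (fps R).
HB.instance Definition _ (R : Type) := gen_choiceMixin (fps R).

Lemma fpsP (R : Type) (f g : fps R) :
  (forall n, fps_coef f n = fps_coef g n) <-> f = g.
Proof.
split=> [|-> //]; case: f g => f [g] /= fg; congr Fps; exact/funext.
Qed.

Section FpsZmodule.
Variable R : zmodType.
Implicit Types f g h : fps R.

Definition fps_zero : fps R := Fps (fun _ => 0).
Definition fps_opp f : fps R := Fps (fun n => - fps_coef f n).
Definition fps_add f g : fps R := Fps (fun n => fps_coef f n + fps_coef g n).

Fact fps_addA : associative fps_add.
Proof. by move=> f g h; apply/fpsP => n; exact: addrA. Qed.
Fact fps_addC : commutative fps_add.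
Proof. by move=> f g; apply/fpsP => n; exact: addrC. Qed.
Fact fps_add0 : left_id fps_zero fps_add.
Proof. by move=> f; apply/fpsP => n; exact: add0r. Qed.
Fact fps_addN : left_inverse fps_zero fps_opp fps_add.
Proof. by move=> f; apply/fpsP => n; exact: addNr. Qed.

HB.instance Definition _ :=
  GRing.isZmodule.Build (fps R) fps_addA fps_addC fps_add0 fps_addN.
End FpsZmodule.

Section FpsRing.
Variable R : comNzRingType.
Implicit Types f g h : fps R.

Definition fpsC (c : R) : fps R := Fps (fun n => if n == 0%N then c else 0).
Definition fpsX : fps R := Fps (fun n => (n == 1%N)%:R).
Definition fps_mul f g : fps R :=
  Fps (fun n => \sum_(i < n.+1) fps_coef f i * fps_coef g (n - i)).

Local Definition trunc N f : {poly R} := \poly_(i < N) fps_coef f i.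

Fact coef_fps_mul N f g n : (n < N)%N ->
  fps_coef (fps_mul f g) n = (trunc N f * trunc N g)`_n.
Proof.
move=> ltnN; rewrite coefM; apply: eq_bigr => i _; rewrite !coef_poly.
by rewrite (leq_ltn_trans _ ltnN) ?leq_ord // (leq_ltn_trans (leq_subr _ _) ltnN).
Qed.

Fact fps_mulC : commutative fps_mul.
Proof.
by move=> f g; apply/fpsP => n; rewrite !(coef_fps_mul _ _ (ltnSn n)) mulrC.
Qed.

Fact fps_mulA : associative fps_mul.
Proof.
move=> f g h; apply/fpsP => n.
transitivity (trunc n.+1 f * (trunc n.+1 g * trunc n.+1 h))`_n.
  rewrite coefM; apply: eq_bigr => i _.
  by rewrite coef_poly ltn_ord -coef_fps_mul // ltnS leq_subr.
rewrite mulrA coefM; apply: eq_bigr => i _.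
by rewrite coef_poly ltnS leq_subr -coef_fps_mul.
Qed.

Fact fps_mul1 : left_id (fpsC 1) fps_mul.
Proof.
move=> f; apply/fpsP => n /=; rewrite big_ord_recl /= mul1r subn0.
by rewrite big1 ?addr0 // => i _; rewrite mul0r.
Qed.

Fact fps_mulDl : left_distributive fps_mul +%R.
Proof.
move=> f g h; apply/fpsP => n /=; rewrite -big_split /=.
by apply: eq_bigr => i _; rewrite mulrDl.
Qed.

Fact fps_one_neq0 : fpsC 1 != 0.
Proof. by apply/eqP => /fpsP /(_ 0%N) /= /eqP; rewrite oner_eq0. Qed.

HB.instance Definition _ := GRing.Zmodule_isComNzRing.Build (fps R)
  fps_mulA fps_mulC fps_mul1 fps_mulDl fps_one_neq0.
End FpsRing.

Arguments fpsX {R}.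

Section FpsUnitRing.
Variable R : comUnitRingType.
Implicit Types f g : fps R.

Definition fps_unit : {pred fps R} := fun f => fps_coef f 0 \is a GRing.unit.

(* The first [n] coefficients [g_0, ..., g_(n-1)] of the inverse of [f], by
   solving [f_0 g_k + f_1 g_(k-1) + ... + f_k g_0 = (k == 0)] for [g_k]. *)
Fixpoint fps_inv_seq f n : seq R :=
  if n is k.+1 then
    let s := fps_inv_seq f k in
    rcons s ((fps_coef f 0)^-1 *
             ((k == 0%N)%:R - \sum_(i < k) fps_coef f (k - i) * s`_i))
  else [::].

Definition fps_inv f : fps R :=
  if f \in fps_unit then Fps (fun n => (fps_inv_seq f n.+1)`_n) else f.

Fact size_fps_inv_seq f n : size (fps_inv_seq f n) = n.
Proof. by elim: n => //= n IHn; rewrite size_rcons IHn. Qed.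

Fact nth_fps_inv_seq f n i : (i < n)%N ->
  (fps_inv_seq f n)`_i = (fps_inv_seq f i.+1)`_i.
Proof.
elim: n => // n IHn; rewrite ltnS leq_eqVlt => /predU1P[-> //| ltin].
by rewrite [LHS]/= nth_rcons size_fps_inv_seq ltin IHn.
Qed.

Fact fps_mulVr : {in fps_unit, left_inverse 1 fps_inv *%R}.
Proof.
move=> f Uf; rewrite mulrC /fps_inv Uf; apply/fpsP => n.
transitivity (\sum_(i < n.+1) fps_coef f (n - i) * (fps_inv_seq f i.+1)`_i).
  rewrite -[LHS]/(\sum_(i < n.+1) fps_coef f i * (fps_inv_seq f (n - i).+1)`_(n - i)).
  rewrite (reindex_inj rev_ord_inj) /=; apply: eq_bigr => i _.
  by rewrite subSS subKn // leq_ord.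
rewrite big_ord_recr /= subnn nth_rcons size_fps_inv_seq ltnn eqxx.
rewrite mulrA divrr // mul1r addrCA.
rewrite (eq_bigr (fun i : 'I_n => fps_coef f (n - i) * (fps_inv_seq f n)`_i)).
  by rewrite subrr addr0; case: (n == 0%N).
by move=> i _; rewrite (nth_fps_inv_seq _ (ltn_ord i)).
Qed.

Fact fps_unitP f g : g * f = 1 -> fps_unit f.
Proof.
move/fpsP/(_ 0%N); rewrite /= big_ord1 subnn => gf1.
by apply/unitrPr; exists (fps_coef g 0); rewrite mulrC.
Qed.

Fact fps_inv_out : {in [predC fps_unit], fps_inv =1 id}.
Proof. by move=> f /negbTE; rewrite /fps_inv => ->. Qed.

HB.instance Definition _ := GRing.ComNzRing_hasMulInverse.Build (fps R)
  fps_mulVr fps_unitP fps_inv_out.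
End FpsUnitRing.


Section Gegenbauer.
Variable F : fieldType.
Implicit Type lam : F.

Definition gegenbauer_coef lam (n : nat) : F :=
  (n%:R * (n%:R - 1 + 2 * lam)) / (4 * (n%:R + lam) * (n%:R - 1 + lam)).

(* The step from 0 to 1, where the coefficient may have a zero denominator, is
   written out separately: C_(-1) = 0 gives C_1 = 'X.  In later steps the
   denominators are nonzero for lam > 0. *)
Fixpoint gegenbauer_nat lam (n : nat) : {poly F} :=
  match n with
  | 0 => 1
  | k.+1 =>
    match k with
    | 0 => 'X
    | j.+1 => 'X * gegenbauer_nat lam k
              - gegenbauer_coef lam k *: gegenbauer_nat lam j
    end
  end.

(* Indexed by [int] because C_(-1) = 0 is needed. *)
Definition gegenbauer lam (k : int) : {poly F} :=
  if k is Posz n then gegenbauer_nat lam n else 0.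

Lemma gegenbauerN1 lam : gegenbauer lam (-1) = 0.
Proof. by []. Qed.

Lemma gegenbauer0 lam : gegenbauer lam 0 = 1.
Proof. by []. Qed.

Lemma gegenbauerS lam (n : nat) :
  gegenbauer lam (n%:Z + 1) = 'X * gegenbauer lam n
    - gegenbauer_coef lam n *: gegenbauer lam (n%:Z - 1).
Proof.
case: n => [|n]; first by rewrite /= scaler0 subr0 mulr1.
by rewrite -PoszD addn1 -[in n.+1%:Z - 1]addn1 PoszD addrK.
Qed.

Definition chebyshevU (k : int) : {poly F} := gegenbauer 1 k.

End Gegenbauer.

(* Main.v *)
Require Import Defs.
From mathcomp Require Import all_boot all_order all_algebra.
From mathcomp Require Import boolp reals complex.
From mathcomp Require Import ring.

Import GRing.Theory.
Local Open Scope ring_scope.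
Local Open Scope complex_scope.

(** The two denominators are the two dilations of a single series.  Indeed
    [t1 * t2 = 1] and [t1 + t2 = 2 * rho], so that [t1 / 4 - rho / 2] equals
    [- t2 / 4] and the first denominator is [t1 * D (t2 * t)], where
    [D (t) = 1 - x t + t^2 / 4]; the second one is obtained by exchanging [t1]
    and [t2].

    The monic Gegenbauer polynomials with parameter [m + 1] are the coefficients
    of [D ^ -(m + 1)], up to the binomial factor [(n + m)! / (n! m!)]
    ([gegenbauer_gfP]): their three-term recurrence says that the generating
    function [G] satisfies [D G' + (m + 1) D' G = 0], hence that
    [D ^ (m + 1) * G] has derivative zero, and so is constant in
    characteristic 0.  After dilation, the coefficient of [t ^ n] on the right
    is the Gegenbauer polynomial, with its binomial factor, times
    [c1 * t2 ^ (n + m + 1) + c2 * t1 ^ (n + m + 1)] ([gegenbauer_gf_homog]).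

    Since [c1] and [c2] have denominators [t2 - t1] and [t1 - t2], this last
    combination involves only quotients [(t2 ^ k - t1 ^ k) / (t2 - t1)], which
    are, up to powers of 2, values of monic Chebyshev polynomials of the second
    kind at [rho], by the analogue of Binet's formula ([chebyshevU_binet]);
    together they form the bracket on the left.  The hypothesis [rho ^ 2 <> 1]
    ensures that [t1] and [t2] differ. *)

Set Implicit Arguments.
Unset Strict Implicit.
Unset Printing Implicit Defensive.

(** * Coefficients, derivative and dilation of formal power series *)

Section FpsCoef.
Variable R : comNzRingType.
Implicit Types (f g : fps R) (c : R).

Lemma fps_coefD f g n : fps_coef (f + g) n = fps_coef f n + fps_coef g n.
Proof. by []. Qed.

Lemma fps_coefN f n : fps_coef (- f) n = - fps_coef f n.
Proof. by []. Qed.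

Lemma fps_coefMn f k n : fps_coef (f *+ k) n = fps_coef f n *+ k.
Proof. by elim: k => // k IHk; rewrite !mulrS fps_coefD IHk. Qed.

Lemma fps_coefM f g n :
  fps_coef (f * g) n = \sum_(i < n.+1) fps_coef f i * fps_coef g (n - i).
Proof. by []. Qed.

Lemma fps_coefCM c f n : fps_coef (fpsC c * f) n = c * fps_coef f n.
Proof.
by rewrite fps_coefM big_ord_recl /= subn0 big1 ?addr0 // => i _; rewrite mul0r.
Qed.

Lemma fps_coefXM f n :
  fps_coef (fpsX * f) n = if n is k.+1 then fps_coef f k else 0.
Proof.
rewrite fps_coefM; case: n => [|n]; first by rewrite big_ord1 /= mul0r.
rewrite !big_ord_recl /= mul0r add0r mul1r subSS subn0.
by rewrite big1 ?addr0 // => i _; rewrite mul0r.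
Qed.

Lemma fpsCM : {morph @fpsC R : a b / a * b}.
Proof.
move=> a b; apply/fpsP => n; rewrite fps_coefCM /=.
by case: eqP; rewrite ?mulr0.
Qed.

Lemma fpsCX c k : fpsC (c ^+ k) = fpsC c ^+ k.
Proof. by elim: k => // k IHk; rewrite !exprS fpsCM IHk. Qed.

Lemma fps_coef0M f g : fps_coef (f * g) 0 = fps_coef f 0 * fps_coef g 0.
Proof. by rewrite fps_coefM big_ord1. Qed.

Lemma fps_coef0X f k : fps_coef (f ^+ k) 0 = fps_coef f 0 ^+ k.
Proof. by elim: k => // k IHk; rewrite !exprS fps_coef0M IHk. Qed.

Definition fps_deriv f : fps R := Fps (fun n => n.+1%:R * fps_coef f n.+1).

Lemma fps_coef_deriv f n :
  fps_coef (fps_deriv f) n = n.+1%:R * fps_coef f n.+1.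
Proof. by []. Qed.

(** A coefficient of a product depends on finitely many coefficients of the
    factors, which allows identities on polynomials to be transported to power
    series. *)
Lemma fps_coefM_poly f g (p q : {poly R}) n :
    (forall i, (i <= n)%N -> p`_i = fps_coef f i) ->
    (forall i, (i <= n)%N -> q`_i = fps_coef g i) ->
  fps_coef (f * g) n = (p * q)`_n.
Proof.
move=> pf qg; rewrite coefM; apply: eq_bigr => i _.
by rewrite pf ?qg ?leq_subr // leq_ord.
Qed.

(** Leibniz's rule at a given order is Leibniz's rule for truncations of the two
    series; one coefficient beyond that order is kept since the derivative
    shifts them. *)
Lemma fps_derivM f g :
  fps_deriv (f * g) = fps_deriv f * g + f * fps_deriv g.
Proof.
apply/fpsP => n; rewrite fps_coefD.
pose T (h : fps R) := \poly_(i < n.+2) fps_coef h i.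
have T_coef h i : (i <= n.+1)%N -> (T h)`_i = fps_coef h i.
  by move=> le_in; rewrite coef_poly ltnS le_in.
have T_deriv h i : (i <= n)%N -> (T h)^`()`_i = fps_coef (fps_deriv h) i.
  by move=> le_in; rewrite coef_deriv T_coef //= mulr_natl.
transitivity (T f * T g)^`()`_n.
  rewrite coef_deriv -mulr_natl; congr (_ * _).
  by apply: fps_coefM_poly => i; exact: T_coef.
rewrite derivM coefD; congr (_ + _); apply/esym/fps_coefM_poly => i le_in;
  by rewrite ?T_deriv ?T_coef // leqW.
Qed.

Lemma fps_derivX f k : fps_deriv (f ^+ k.+1) = f ^+ k * fps_deriv f *+ k.+1.
Proof.
elim: k => [|k IHk]; first by rewrite expr0 mul1r.
rewrite exprS fps_derivM IHk [in RHS]mulrS mulrnAr mulrA -exprS.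
by rewrite [fps_deriv f * _]mulrC.
Qed.

(** Composition with [c * fpsX], hence a ring morphism. *)
Definition fps_rescale c f : fps R := Fps (fun n => c ^+ n * fps_coef f n).

Lemma fps_coef_rescale c f n :
  fps_coef (fps_rescale c f) n = c ^+ n * fps_coef f n.
Proof. by []. Qed.

Lemma fps_rescaleM c : {morph fps_rescale c : f g / f * g}.
Proof.
move=> f g; apply/fpsP => n /=; rewrite mulr_sumr; apply: eq_bigr => i _.
by rewrite mulrACA -exprD subnKC // leq_ord.
Qed.

Lemma fps_rescale1 c : fps_rescale c 1 = 1.
Proof. by apply/fpsP => -[|n] /=; rewrite ?mulr0 ?mul1r. Qed.

Lemma fps_rescaleX c f k : fps_rescale c (f ^+ k) = fps_rescale c f ^+ k.
Proof.
by elim: k => [|k IHk]; rewrite ?fps_rescale1 // !exprS fps_rescaleM IHk.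
Qed.

End FpsCoef.

(** * The generating function of the Gegenbauer polynomials *)

Section GeneratingFunctions.
Variable F : numFieldType.
Implicit Types (a b x rho : F) (f : fps F).

Lemma natr1_neq0 n : n.+1%:R != 0 :> F.
Proof. by rewrite Num.Theory.pnatr_eq0. Qed.

Lemma fps_deriv_eq0 f : fps_deriv f = 0 -> f = fpsC (fps_coef f 0).
Proof.
move/fpsP => df0; apply/fpsP => -[|n] //=.
by move/eqP: (df0 n); rewrite /= mulf_eq0 (negPf (natr1_neq0 n)) => /eqP.
Qed.

Definition gegenbauer_denom x : fps F :=
  1 - fpsC x * fpsX + fpsC 4^-1 * fpsX ^+ 2.

(** The binomial factor is the quotient of the rising factorial of [m + 1] of
    length [n] by [n!].  It is what turns the monic Gegenbauer polynomials into
    the classical ones, up to the factor [2 ^ n] which makes the denominator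
    [1 - x t + t^2 / 4] instead of [1 - 2 x t + t^2]. *)
Definition gegenbauer_gf m x : fps F :=
  Fps (fun n => 'C(n + m, m)%:R * (gegenbauer m.+1%:R n).[x]).

Lemma binrS n m :
  n.+1%:R * 'C(n.+1 + m, m)%:R = (n + m).+1%:R * 'C(n + m, m)%:R :> F.
Proof.
rewrite -!natrM -[(n + m)%N in RHS]/((n.+1 + m).-1) -addSn.
by rewrite mul_bin_down addnK.
Qed.

Lemma coef_gegenbauer_gf m x n :
  fps_coef (gegenbauer_gf m x) n
  = 'C(n + m, m)%:R * (gegenbauer m.+1%:R n).[x].
Proof. by []. Qed.

(** The binomial factor clears the denominators of the monic recurrence: the
    new coefficients are affine in [n], as those of a first order linear
    differential equation must be. *)
Lemma gegenbauer_gf_rec m x n :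
  n.+2%:R * fps_coef (gegenbauer_gf m x) n.+2 =
    (n + m).+2%:R * x * fps_coef (gegenbauer_gf m x) n.+1
    - (n + 2 * m.+1)%:R / 4 * fps_coef (gegenbauer_gf m x) n.
Proof.
(* All three coefficients are expressed with the binomial of the middle one. *)
have -> : fps_coef (gegenbauer_gf m x) n
        = n.+1%:R * 'C(n.+1 + m, m)%:R / (n + m).+1%:R
          * (gegenbauer m.+1%:R n).[x].
  rewrite coef_gegenbauer_gf binrS; congr (_ * _).
  by rewrite mulrAC mulfV ?natr1_neq0 // mul1r.
have -> : n.+2%:R * fps_coef (gegenbauer_gf m x) n.+2
        = (n + m).+2%:R * 'C(n.+1 + m, m)%:R
          * (x * (gegenbauer m.+1%:R n.+1).[x]
             - gegenbauer_coef m.+1%:R n.+1 * (gegenbauer m.+1%:R n).[x]).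
  by rewrite coef_gegenbauer_gf mulrA binrS addSn /= !hornerE.
rewrite coef_gegenbauer_gf /gegenbauer_coef.
have -> : n.+1%:R - 1 = n%:R :> F by rewrite -natr1 addrK.
rewrite natrD natrM.
have -> : n.+1%:R + m.+1%:R = (n + m).+2%:R :> F by rewrite -natrD addnS.
have -> : n%:R + m.+1%:R = (n + m).+1%:R :> F by rewrite -natrD addnS.
move: (natr1_neq0 (n + m)) (natr1_neq0 (n + m).+1).
move: (n + m).+1%:R (n + m).+2%:R => u v u0 v0.
by field; rewrite u0 v0.
Qed.

Lemma coef_gegenbauer_denomM x f n :
  fps_coef (gegenbauer_denom x * f) n =
    fps_coef f n - x * (if n is k.+1 then fps_coef f k else 0)
    + 4^-1 * (if n is k.+2 then fps_coef f k else 0).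
Proof.
rewrite mulrDl mulrBl mul1r expr2 -!mulrA fps_coefD fps_coefD fps_coefN.
by rewrite !fps_coefCM !fps_coefXM; case: n => [|n] //; rewrite fps_coefXM.
Qed.

Lemma gegenbauer_denom_deriv x :
  fps_deriv (gegenbauer_denom x) = fpsC 2^-1 * fpsX - fpsC x.
Proof.
apply/fpsP => n; rewrite fps_coefD fps_coefN fps_coefCM.
(* The coefficients of the denominator are those of its product with 1. *)
rewrite fps_coef_deriv -[gegenbauer_denom x]mulr1 coef_gegenbauer_denomM.
by case: n => [|[|n]] /=; field.
Qed.

(** The differential equation of [D ^ -(m + 1)]: from order 1 on, its
    coefficients are the recurrence [gegenbauer_gf_rec]. *)
Lemma gegenbauer_gf_ode m x :
  gegenbauer_denom x * fps_deriv (gegenbauer_gf m x)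
    + gegenbauer_gf m x * fps_deriv (gegenbauer_denom x) *+ m.+1 = 0.
Proof.
rewrite gegenbauer_denom_deriv mulrDr mulrN [_ * (fpsC _ * _)]mulrCA.
rewrite [_ * fpsX]mulrC [_ * fpsC x]mulrC.
apply/fpsP => n; rewrite fps_coefD fps_coefMn fps_coefD fps_coefN !fps_coefCM.
rewrite coef_gegenbauer_denomM fps_coefXM [RHS]/= -[_ *+ m.+1]mulr_natl.
case: n => [|n].
  rewrite fps_coef_deriv !coef_gegenbauer_gf mulrA binrS add0n binn /=.
  rewrite hornerC hornerX.
  by ring.
have -> : (if n is k.+1 then fps_coef (fps_deriv (gegenbauer_gf m x)) k else 0)
          = n%:R * fps_coef (gegenbauer_gf m x) n.
  by case: n => [|n]; rewrite ?mul0r.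
rewrite !fps_coef_deriv gegenbauer_gf_rec.
move: (fps_coef _ _) (fps_coef _ _) => a1 a0.
by field.
Qed.

(** The derivative of the left-hand side is [D ^ m] times the left-hand side of
    [gegenbauer_gf_ode]; it vanishes, and the constant coefficient is 1. *)
Lemma gegenbauer_gfP m x :
  gegenbauer_denom x ^+ m.+1 * gegenbauer_gf m x = 1.
Proof.
rewrite [LHS]fps_deriv_eq0; last first.
  rewrite fps_derivM fps_derivX -[RHS](mulr0 (gegenbauer_denom x ^+ m)).
  rewrite -(gegenbauer_gf_ode m x) mulrDr addrC exprSr mulrA; congr (_ + _).
  by rewrite -mulrnAr -mulrA mulrnAl [fps_deriv _ * _]mulrC.
rewrite fps_coef0M fps_coef0X -[gegenbauer_denom x]mulr1.
rewrite coef_gegenbauer_denomM coef_gegenbauer_gf add0n binn hornerC.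
by rewrite !mulr0 subr0 addr0 expr1n !mulr1.
Qed.

(** As [a * b = 1], the quadratic denominator is [a] times the dilation by [b]
    of [gegenbauer_denom x]; inverting the [m + 1]st power of [a] contributes
    [b ^ (m + 1)] to the exponent of [b]. *)
Lemma gegenbauer_gf_homog (m : nat) a b c x : a * b = 1 ->
  fpsC c / (fpsC a - fpsC x * fpsX - fpsC (- (b / 4)) * fpsX ^+ 2) ^+ m.+1
  = Fps (fun n => c * b ^+ (n + m).+1 * 'C(n + m, m)%:R
                  * (gegenbauer m.+1%:R n).[x]).
Proof.
move=> ab1; set D := _ - _ - _.
have -> : D = fpsC a * fps_rescale b (gegenbauer_denom x).
  apply/fpsP => n; rewrite /D -[gegenbauer_denom x]mulr1 fps_coefCM.
  rewrite fps_coef_rescale coef_gegenbauer_denomM expr2.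
  rewrite fps_coefD fps_coefN fps_coefD fps_coefN !fps_coefCM fps_coefXM.
  by case: n => [|[|[|n]]] /=; ring: ab1.
have inv : (fpsC a * fps_rescale b (gegenbauer_denom x)) ^+ m.+1
           * (fpsC (b ^+ m.+1) * fps_rescale b (gegenbauer_gf m x)) = 1.
  rewrite exprMn mulrACA -fpsCX -fpsCM -exprMn ab1 expr1n mul1r.
  by rewrite -fps_rescaleX -fps_rescaleM gegenbauer_gfP fps_rescale1.
rewrite (mulr1_eq inv); apply/fpsP => n.
by rewrite !fps_coefCM /= -addnS exprD; ring.
Qed.

(** * Chebyshev polynomials at half a sum of two inverse numbers *)

(** At [n = 0] the coefficient of the Gegenbauer recurrence is 0 rather than
    [1 / 4], but it multiplies [U_(-1) = 0]. *)
Lemma chebyshevU_rec n :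
  chebyshevU F n.+1
  = 'X * chebyshevU F n - 4^-1 *: chebyshevU F (n%:Z - 1).
Proof.
rewrite /chebyshevU -addn1 PoszD gegenbauerS; congr (_ - _).
case: n => [|n]; first by rewrite gegenbauerN1 !scaler0.
congr (_ *: _); rewrite /gegenbauer_coef.
move: (natr1_neq0 n) (natr1_neq0 n.+1); rewrite -[n.+2%:R]natr1 subrK.
have -> : n.+1%:R - 1 + 2 * 1 = n.+1%:R + 1 :> F by ring.
by move: n.+1%:R => u u0 v0; field; rewrite u0 v0.
Qed.

(** [a] and [b] are the roots of [z^2 - 2 rho z + 1], the characteristic
    polynomial of the recurrence of [2 ^ n * U_n (rho)].  The index [n - 1]
    includes [U_(-1)], needed when [n + m = 0] in the theorem; the factor 2 on
    the right accounts for the power [2 ^ n], instead of [2 ^ (n - 1)], on the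
    left. *)
Lemma chebyshevU_binet rho a b n : a * b = 1 -> a + b = 2 * rho ->
  (b - a) * (2 ^+ n * (chebyshevU F (n%:Z - 1)).[rho]) = 2 * (b ^+ n - a ^+ n).
Proof.
move=> ab1 abrho.
have subS k : k.+1%:Z - 1 = k%:Z by rewrite intS addrC addKr.
pose P k := (b - a) * (2 ^+ k * (chebyshevU F (k%:Z - 1)).[rho])
            = 2 * (b ^+ k - a ^+ k).
suff [] : P n /\ P n.+1 by [].
elim: n => [|n [IH0 IH1]]; rewrite /P.
  rewrite subS -[chebyshevU _ (_ - _)]/0 -[chebyshevU _ _]/1 horner0 hornerC.
  by split; ring.
rewrite /P subS in IH0 IH1; rewrite !subS; split=> //.
rewrite chebyshevU_rec hornerD hornerN hornerM hornerX hornerZ.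
set U := (chebyshevU F n).[rho] in IH1 *.
set V := (chebyshevU F (_ - _)).[rho] in IH0 *.
transitivity (2 * rho * ((b - a) * (2 ^+ n.+1 * U)) - (b - a) * (2 ^+ n * V)).
  by rewrite !exprS; field.
by rewrite IH0 IH1 -abrho !exprS; ring: ab1.
Qed.

End GeneratingFunctions.

(** * Sum of the two dilated generating functions *)

Unset Implicit Arguments.

Theorem theorem4p1 (R : realType) (m : nat) (rho alpha1 x s : R[i])
    (hrho : rho ^+ 2 != 1) (hs : s ^+ 2 = rho ^+ 2 - 1) :
  let t1 := rho - s in
  let t2 := rho + s in
  let c1 := (1 + (alpha1 - 2 * rho) * t1) / (t2 - t1) in
  let c2 := (1 + (alpha1 - 2 * rho) * t2) / (t1 - t2) in
  Fps (fun n : nat =>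
    ((n + m)`! * 2 ^ (n + m))%:R / (n`! * m`!)%:R
    * ((chebyshevU _ (n + m)%N).[rho]
       + (alpha1 / 2 - rho) * (chebyshevU _ ((n + m)%N%:Z - 1)).[rho])
    * (gegenbauer m.+1%:R n).[x])
  = fpsC c1 / (fpsC t1 - fpsC x * fpsX
               - fpsC (t1 / 4 - rho / 2) * fpsX ^+ 2) ^+ m.+1
  + fpsC c2 / (fpsC t2 - fpsC x * fpsX
               - fpsC (t2 / 4 - rho / 2) * fpsX ^+ 2) ^+ m.+1.
Proof.
move=> t1 t2 c1 c2.
have t12 : t1 * t2 = 1 by rewrite /t1 /t2 -subr_sqr hs; ring.
have t12D : t1 + t2 = 2 * rho by rewrite /t1 /t2; ring.
have d_neq0 : t2 - t1 != 0.
  have -> : t2 - t1 = 2 * s by rewrite /t1 /t2; ring.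
  by rewrite mulf_neq0 ?natr1_neq0 // -sqrf_eq0 hs subr_eq0.
have -> : t1 / 4 - rho / 2 = - (t2 / 4) by rewrite /t1 /t2; field.
have -> : t2 / 4 - rho / 2 = - (t1 / 4) by rewrite /t1 /t2; field.
rewrite !gegenbauer_gf_homog //; last by rewrite mulrC.
apply/fpsP => n; rewrite fps_coefD /=.
set N := (n + m)%N.
have binE : 'C(N, m)%:R = N`!%:R / (n`! * m`!)%:R :> R[i].
  rewrite -(@bin_fact N m) ?leq_addl // addnK [(m`! * _)%N]mulnC natrM mulfK //.
  by rewrite Num.Theory.pnatr_eq0 -lt0n muln_gt0 !fact_gt0.
rewrite natrM natrX [_ * 2 ^+ N / _]mulrAC -binE.
(* [t1 * t2 = 1] lowers one factor [t1 * t2 ^ N.+1] to [t2 ^ N]. *)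
have c1E : c1 * t2 ^+ N.+1
           = (t2 ^+ N.+1 + (alpha1 - 2 * rho) * t2 ^+ N) / (t2 - t1).
  by rewrite /c1 mulrAC exprS; congr (_ / _); ring: t12.
have c2E : c2 * t1 ^+ N.+1
           = - (t1 ^+ N.+1 + (alpha1 - 2 * rho) * t1 ^+ N) / (t2 - t1).
  rewrite /c2 -[t1 - t2]opprB invrN mulrN mulNr mulrAC exprS mulNr.
  by congr (- (_ / _)); ring: t12.
have UVE : 2 ^+ N * ((chebyshevU R[i] N).[rho]
             + (alpha1 / 2 - rho) * (chebyshevU R[i] (N%:Z - 1)).[rho])
         = (t2 ^+ N.+1 - t1 ^+ N.+1 + (alpha1 - 2 * rho) * (t2 ^+ N - t1 ^+ N))
           / (t2 - t1).
  apply: (mulIf d_neq0); rewrite divfK //.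
  (* The factor 2 matches the right-hand side of [chebyshevU_binet]. *)
  apply: (mulfI (natr1_neq0 _ 1)).
  rewrite [RHS]mulrDr [2 * (_ * (_ ^+ N - _))]mulrCA.
  have := chebyshevU_binet N.+1 t12 t12D; rewrite intS [1 + _]addrC addrK => EU.
  rewrite -(chebyshevU_binet N t12 t12D) -EU exprS.
  by field.
rewrite -mulrA mulrA -[_ * 2 ^+ N * _]mulrA UVE c1E c2E.
by ring.
Qed.
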